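(* Let $d,k\in\mathbb N$, let $\odot$ be a universal product in $\mathbf{AlgP}_d$ over $I=[k]$ and let $\varepsilon\in\mathbb A_k$, $n=|\varepsilon|$. Then there exist constants $\alpha^{(\varepsilon)}_{\pi_1,\dots,\pi_k}\in\mathbb C^d$, $\pi_i\in\mathcal M_d(X^{(i)})$, uniquely determined by $\odot$, such that $$\bigl(\odot_{i=1}^k\varphi_i\bigr)(a_1\cdots a_n)=\sum_{\pi_1\in\mathcal M_d(X^{(1)})}\cdots\sum_{\pi_k\in\mathcal M_d(X^{(k)})}\alpha^{(\varepsilon)}_{\pi_1,\dots,\pi_k}\prod_{(M_1,l_1)\in\pi_1}\varphi_1^{(l_1)}\bigl(j(a_1,\dots,a_n)(M_1)\bigr)\cdots\prod_{(M_k,l_k)\in\pi_k}\varphi_k^{(l_k)}\bigl(j(a_1,\dots,a_n)(M_k)\bigr)$$ for all objects $(A_1,\varphi_1),\dots,(A_k,\varphi_k)$ of $\mathbf{AlgP}_d$ and all $a_1\cdots a_n\in A_\varepsilon$.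
   Context: Vector spaces are complex; algebras are complex associative, not necessarily unital. $[d]=\{1,\dots,d\}$, $X_n=\{x_1,\dots,x_n\}$. $\langle X\rangle$ is the free semigroup on $X$ (words of length $\ge1$), $\mathbb C\langle X\rangle$ its semigroup algebra, $[Y]$ the free commutative monoid on $Y$. For a word $M=y_1\cdots y_r$: $\mathrm{set}\,M=\{y_1,\dots,y_r\}$, $|M|=r$. $V^{*d}:=(V^* )^d$; $\varphi\circ j$ is taken componentwise. For $a_1,\dots,a_n$ in an algebra $A$, $j(a_1,\dots,a_n):\mathbb C\langle X_n\rangle\to A$ is the algebra homomorphism with $x_i\mapsto a_i$. $\mathbb A_k$ is the set of finite sequences $\varepsilon=(\varepsilon_1,\dots,\varepsilon_n)$, $n\in\mathbb N$, in $[k]$ with $\varepsilon_j\ne\varepsilon_{j+1}$; $|\varepsilon|=n$. For algebras $A_1,\dots,A_k$ the free product is $A_1\sqcup\dots\sqcup A_k=\bigoplus_{\varepsilon\in\mathbb A_k}A_\varepsilon$, $A_\varepsilon=A_{\varepsilon_1}\otimes\dots\otimes A_{\varepsilon_n}$ (the coproduct of non-unital algebras); $a_1\cdots a_n\in A_\varepsilon$ denotes $a_1\otimes\dots\otimes a_n$ with $a_i\in A_{\varepsilon_i}$. $j_1\,\underline\sqcup\cdots\underline\sqcup\,j_k:B_1\sqcup\dots\sqcup B_k\to A_1\sqcup\dots\sqcup A_k$ is the algebra homomorphism acting as $j_i:B_i\to A_i$ on $B_i$. $\mathbf{AlgP}_d$ has as objects pairs $(A,\varphi)$, $A$ an algebra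 and $\varphi=(\varphi^{(1)},\dots,\varphi^{(d)})\in A^{*d}$; morphisms $(B,\psi)\to(A,\varphi)$ are algebra homomorphisms $j:B\to A$ with $\varphi\circ j=\psi$. A universal product over $I=[k]$ assigns to each family of objects $(A_i,\varphi_i)_{i\in[k]}$ an element $\odot_{i=1}^k\varphi_i\in(A_1\sqcup\dots\sqcup A_k)^{*d}$ such that $(\odot_i\varphi_i)\circ(j_1\,\underline\sqcup\cdots\underline\sqcup\,j_k)=\odot_i(\varphi_i\circ j_i)$ for all algebra homomorphisms $j_i:B_i\to A_i$. (Convention: a product of two factors is assumed non-degenerate, i.e. it is not the case that $(\varphi_1\odot\varphi_2)(a_1\cdots a_p)=0$ for all objects, all $\varepsilon\in\mathbb A_2$ with $p=|\varepsilon|>1$ and all $a_1\cdots a_p\in A_\varepsilon$.) The value $(\odot_i\varphi_i)(a)$ is the vector in $\mathbb C^d$ of the values of the $d$ components. For given $\varepsilon$, $X^{(i)}=\{x_l\in X_n:\varepsilon_l=i\}$. For a finite set $X$, $\mathcal M(X)$ is the set of elements $M_1\cdot\ldots\cdot M_r$ of $[\langle X\rangle]$ with $|M_1|+\dots+|M_r|=\#X$, the $\mathrm{set}\,M_s$ pairwise disjoint and $\#\,\mathrm{set}\,M_s=|M_s|$; $\mathcal M_d(X)=\{(M_1,k_1)\cdot\ldots\cdot(M_r,k_r):M_1\cdot\ldots\cdot M_r\in\mathcal M(X),\ k_s\in[d]\}\subset[\langle X\rangle\times[d]]$ (so $\mathcal M_d(\emptyset)=\{1\}$). $(M,l)\in\pi$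 means that $(M,l)$ is a factor of $\pi$. For $M\in\langle X^{(i)}\rangle$, $j(a_1,\dots,a_n)(M)$ is the product in $A_i$ obtained by substituting $a_l$ for $x_l$. *)

(* Defs.v *)
From HB Require Import structures.
From mathcomp Require Import all_boot all_order all_algebra finmap multiset generic_quotient.
From mathcomp Require Import boolp classical_sets functions cardinality fsbigop.

Set Implicit Arguments.
Unset Strict Implicit.
Unset Printing Implicit Defensive.

Import GRing.Theory.

Local Open Scope ring_scope.
Local Open Scope quotient_scope.

HB.mixin Record Lmodule_isAssocAlgebra (K : fieldType) V
    of GRing.Lmodule K V := {
  amul : V -> V -> V;
  amulA : associative amul;
  amulDl : left_distributive amul +%R;
  amulDr : right_distributive amul +%R;
  amulZl : forall (c : K) x y, amul (c *: x) y = c *: amul x y;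
  amulZr : forall (c : K) x y, amul x (c *: y) = c *: amul x y
}.

#[short(type="assocAlgType")]
HB.structure Definition AssocAlgebra (K : fieldType) :=
  {V of Lmodule_isAssocAlgebra K V & GRing.Lmodule K V}.

Record alg_hom (K : fieldType) (A B : assocAlgType K) := AlgHom {
  hom_lin :> {linear A -> B};
  homM : {morph hom_lin : x y / amul x y}
}.

Definition alternating k (e : seq 'I_k) : bool :=
  (e != [::]) && sorted [rel i j | i != j] e.

Record altseq k := AltSeq {
  altval :> seq 'I_k;
  altvalP : alternating altval
}.

(* The free product of a finite family of algebras. The underlying vector
   space is the direct sum, over the nonempty alternating e, of the tensor
   products A_(e_1) (x) ... (x) A_(e_n). A pure tensor is encoded by its list
   of tagged factors, the tags giving e; an element is a formal linear
   combination of pure tensors, and two combinations are identified when no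
   map that is multilinear in the factors (separately for each e)
   distinguishes them, as in the construction of the tensor product by its
   universal property. Together with the product below this is the coproduct
   of non-unital algebras: see fp_lift_in and fp_lift_unique. *)

Section FreeProduct.
Variables (K : fieldType) (k : nat) (A : 'I_k -> assocAlgType K).
Implicit Types (E : lmodType K).

Definition factor := {i : 'I_k & A i}.
Definition tags (w : seq factor) : seq 'I_k := [seq tag x | x <- w].

Definition pure_tensor := {w : seq factor | alternating (tags w)}.

Definition multilinear (E : lmodType K) (f : seq factor -> E) : Prop :=
  forall (u v : seq factor) (i : 'I_k) (c : K) (a b : A i),
    alternating (tags u ++ i :: tags v) ->
    f (u ++ Tagged A (c *: a + b) :: v) =
      c *: f (u ++ Tagged A a :: v) + f (u ++ Tagged A b :: v).

Definition formal_sum := seq (K * pure_tensor).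

Definition fs_eval (E : lmodType K) (f : seq factor -> E) (s : formal_sum) : E :=
  \sum_(p <- s) p.1 *: f (val p.2).

Definition tensor_eq (s t : formal_sum) : Prop :=
  forall (E : lmodType K) (f : seq factor -> E),
    multilinear f -> fs_eval f s = fs_eval f t.

Definition tensor_eqb (s t : formal_sum) : bool := `[< tensor_eq s t >].

Lemma tensor_eqb_refl : reflexive tensor_eqb.
Proof. by move=> s; apply/asboolP. Qed.

Lemma tensor_eqb_sym : symmetric tensor_eqb.
Proof.
by move=> s t; apply/idP/idP => /asboolP h; apply/asboolP => E f fm; rewrite h.
Qed.

Lemma tensor_eqb_trans : transitive tensor_eqb.
Proof.
move=> t s u /asboolP h1 /asboolP h2; apply/asboolP => E f fm.
by rewrite h1 // h2.
Qed.

Canonical tensor_equiv :=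
  EquivRel tensor_eqb tensor_eqb_refl tensor_eqb_sym tensor_eqb_trans.

Definition free_product := {eq_quot tensor_equiv}.

HB.instance Definition _ := Choice.on free_product.
HB.instance Definition _ := EqQuotient.on free_product.

Lemma tensor_pi (s t : formal_sum) :
  \pi_free_product s = \pi_free_product t <-> tensor_eq s t.
Proof.
split=> [/eqmodP/asboolP //|h]; apply/eqmodP; exact/asboolP.
Qed.

Lemma tensor_repr (s : formal_sum) : tensor_eq (repr (\pi_free_product s)) s.
Proof. by apply/tensor_pi; rewrite reprK. Qed.

Definition fs_scale (c : K) (s : formal_sum) : formal_sum :=
  [seq (c * p.1, p.2) | p <- s].

Lemma fs_eval_cat E (f : _ -> E) s t :
  fs_eval f (s ++ t) = fs_eval f s + fs_eval f t.
Proof. by rewrite /fs_eval big_cat. Qed.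

Lemma fs_eval_scale E (f : _ -> E) c s :
  fs_eval f (fs_scale c s) = c *: fs_eval f s.
Proof.
by rewrite /fs_eval big_map scaler_sumr; apply: eq_bigr => p _; rewrite scalerA.
Qed.

Definition fp_add (x y : free_product) : free_product :=
  \pi_free_product (repr x ++ repr y).
Definition fp_scale (c : K) (x : free_product) : free_product :=
  \pi_free_product (fs_scale c (repr x)).
Definition fp_zero : free_product := \pi_free_product [::].
Definition fp_opp (x : free_product) : free_product := fp_scale (-1) x.

Definition fp_eval E (f : seq factor -> E) (x : free_product) : E :=
  fs_eval f (repr x).

Lemma fp_evalP (x y : free_product) :
  (forall E (f : seq factor -> E), multilinear f -> fp_eval f x = fp_eval f y) ->
  x = y.
Proof. by move=> h; rewrite -[x]reprK -[y]reprK; apply/tensor_pi. Qed.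

Section Eval.
Variables (E : lmodType K) (f : seq factor -> E).
Hypothesis fm : multilinear f.

Lemma fp_eval_pi s : fp_eval f (\pi_free_product s) = fs_eval f s.
Proof. exact: tensor_repr. Qed.

Lemma fp_evalD x y : fp_eval f (fp_add x y) = fp_eval f x + fp_eval f y.
Proof. by rewrite /fp_add fp_eval_pi fs_eval_cat. Qed.

Lemma fp_evalZ c x : fp_eval f (fp_scale c x) = c *: fp_eval f x.
Proof. by rewrite /fp_scale fp_eval_pi fs_eval_scale. Qed.

Lemma fp_eval0 : fp_eval f fp_zero = 0.
Proof. by rewrite /fp_zero fp_eval_pi /fs_eval big_nil. Qed.

Lemma fp_evalN x : fp_eval f (fp_opp x) = - fp_eval f x.
Proof. by rewrite fp_evalZ scaleN1r. Qed.
End Eval.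

Lemma fp_addA : associative fp_add.
Proof. by move=> x y z; apply: fp_evalP => E f fm; rewrite !fp_evalD // addrA. Qed.
Lemma fp_addC : commutative fp_add.
Proof. by move=> x y; apply: fp_evalP => E f fm; rewrite !fp_evalD // addrC. Qed.
Lemma fp_add0 : left_id fp_zero fp_add.
Proof.
by move=> x; apply: fp_evalP => E f fm; rewrite fp_evalD // fp_eval0 // add0r.
Qed.
Lemma fp_addN : left_inverse fp_zero fp_opp fp_add.
Proof.
move=> x; apply: fp_evalP => E f fm.
by rewrite fp_evalD // fp_evalN // fp_eval0 // addNr.
Qed.

HB.instance Definition _ :=
  GRing.isZmodule.Build free_product fp_addA fp_addC fp_add0 fp_addN.

Lemma fp_scaleA a b x : fp_scale a (fp_scale b x) = fp_scale (a * b) x.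
Proof. by apply: fp_evalP => E f fm; rewrite !fp_evalZ // scalerA. Qed.
Lemma fp_scale1 : left_id 1 fp_scale.
Proof. by move=> x; apply: fp_evalP => E f fm; rewrite fp_evalZ // scale1r. Qed.
Lemma fp_scaleDr : right_distributive fp_scale +%R.
Proof.
by move=> c x y; apply: fp_evalP => E f fm; rewrite !(fp_evalZ, fp_evalD) // scalerDr.
Qed.
Lemma fp_scaleDl x : {morph fp_scale^~ x : a b / a + b}.
Proof.
by move=> a b; apply: fp_evalP => E f fm; rewrite !(fp_evalZ, fp_evalD) // scalerDl.
Qed.

HB.instance Definition _ :=
  GRing.Zmodule_isLmodule.Build K free_product
    fp_scaleA fp_scale1 fp_scaleDr fp_scaleDl.

Lemma fp_eval_linear E (f : seq factor -> E) : multilinear f -> linear (fp_eval f).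
Proof. by move=> fm c x y; rewrite fp_evalD // fp_evalZ. Qed.

(* Pure tensors are multiplied by concatenation, the two factors that meet
   being multiplied with each other when they belong to the same algebra. *)

Definition push (x : factor) (v : seq factor) : seq factor :=
  if v is y :: v' then
    match tag x =P tag y with
    | ReflectT e => Tagged A (amul (ecast i (A i) e (tagged x)) (tagged y)) :: v'
    | ReflectF _ => x :: v
    end
  else [:: x].

Arguments push : simpl never.

Definition wmul (u v : seq factor) : seq factor := foldr push v u.

Lemma push_same i (a b : A i) v :
  push (Tagged A a) (Tagged A b :: v) = Tagged A (amul a b) :: v.
Proof. by rewrite /push /=; case: eqP => // e; rewrite eq_axiomK. Qed.

Lemma push_diff x y v : tag x != tag y -> push x (y :: v) = x :: y :: v.
Proof. by rewrite /push; case: eqP. Qed.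

Lemma push_mul i (a b : A i) v :
  push (Tagged A (amul a b)) v = push (Tagged A a) (push (Tagged A b) v).
Proof.
case: v => [|[j c] v]; first by rewrite push_same.
have [e|ne] := eqVneq i j.
  by case: j / e c => c; rewrite -/(Tagged A c) !push_same amulA.
by rewrite !(push_diff (y := existT _ j c)) ?push_same.
Qed.

Lemma tags_push x v : exists v', tags (push x v) = tag x :: v' /\
  (tags v = v' \/ tags v = tag x :: v').
Proof.
case: v => [|y v]; first by exists [::]; split; [|left].
rewrite /push; case: eqP => [e|_] /=; last by exists (tag y :: tags v); split; [|left].
by exists (tags v); split; [rewrite e|right; rewrite e].
Qed.

Lemma wmul_push x u v : wmul (push x u) v = push x (wmul u v).
Proof.
case: u => [//|y u] /=; have [e|ne] := eqVneq (tag x) (tag y); last first.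
  by rewrite push_diff.
case: x y e => i a [j b] /= e; case: j / e b => b.
by rewrite -/(Tagged A b) -/(Tagged A a) push_same /= push_mul.
Qed.

Lemma wmulA : associative wmul.
Proof.
move=> u v w; elim: u => //= x u IHu.
by rewrite IHu wmul_push.
Qed.

Lemma sorted_push x v : sorted [rel i j | i != j] (tags v) ->
  sorted [rel i j | i != j] (tags (push x v)).
Proof.
case: v => [//|y v] sv; rewrite /push; case: eqP => [e|/eqP ne] //=.
by rewrite ne.
Qed.

Lemma wmul_alt u v : alternating (tags u) -> alternating (tags v) ->
  alternating (tags (wmul u v)).
Proof.
move=> _ /andP[v0 sv]; apply/andP; split.
  case: u => [//|x u] /=.
  by have [v' [-> _]] := tags_push x (wmul u v).
by elim: u => //= x u; exact: sorted_push.
Qed.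

Definition pt_mul (u v : pure_tensor) : pure_tensor :=
  exist _ (wmul (val u) (val v)) (wmul_alt (valP u) (valP v)).

Definition fs_mul (s t : formal_sum) : formal_sum :=
  [seq (p.1 * q.1, pt_mul p.2 q.2) | p <- s, q <- t].

Definition fp_mul (x y : free_product) : free_product :=
  \pi_free_product (fs_mul (repr x) (repr y)).

Lemma sum_fs_mul E (F : K * pure_tensor -> E) s t :
  \sum_(o <- fs_mul s t) F o =
  \sum_(p <- s) \sum_(q <- t) F (p.1 * q.1, pt_mul p.2 q.2).
Proof. exact: big_allpairs_dep. Qed.

Lemma fs_eval_mul E (f : _ -> E) s t :
  fs_eval f (fs_mul s t) =
  \sum_(p <- s) \sum_(q <- t) (p.1 * q.1) *: f (wmul (val p.2) (val q.2)).
Proof. exact: sum_fs_mul. Qed.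

Lemma altE (u : seq 'I_k) : alternating u = (u != [::]) && sorted [rel i j | i != j] u.
Proof. by []. Qed.

Lemma alt_cat_sorted (u : seq 'I_k) i v : alternating (u ++ i :: v) ->
  sorted [rel i j | i != j] (u ++ [:: i]) /\ sorted [rel i j | i != j] (i :: v).
Proof.
rewrite altE => /andP[_]; case: u => [|x u] //=.
by rewrite !cat_path /= => /and3P[-> -> ->].
Qed.

Lemma alt_glue (u : seq 'I_k) i v :
  sorted [rel i j | i != j] (u ++ [:: i]) ->
  sorted [rel i j | i != j] (i :: v) -> alternating (u ++ i :: v).
Proof.
by case: u => [|x u] //=; rewrite altE /= !cat_path /= andbT => /andP[-> ->] ->.
Qed.

Lemma wmul_catl u x v : sorted [rel i j | i != j] (tags u ++ [:: tag x]) ->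
  wmul u (x :: v) = u ++ x :: v.
Proof.
elim: u => [//|y u IHu] /= h.
rewrite IHu; last by case: u h {IHu} => //= z u /andP[].
case: u h {IHu} => [|z u] /=; first by rewrite andbT => h; rewrite push_diff.
by case/andP=> h _; rewrite push_diff.
Qed.

Lemma wmul_cons_tag u i v : tags u = i :: v ->
  forall w, exists a : A i, exists2 t, wmul u w = Tagged A a :: t
    & (alternating (tags u) -> alternating (tags w) ->
       sorted [rel i j | i != j] (i :: tags t)).
Proof.
case: u => [//|[j b] u] /= [eij _] w; case: i / eij.
have [t [e1 _]] := tags_push (existT _ j b) (wmul u w).
move: e1; case E: (push _ _) => [//|[l c] s] /= [e1 e2].
case: j / e1 b E => b E; exists c; exists s => // hu hw.
have := @wmul_alt (existT _ l b :: u) w hu hw.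
by rewrite /= E => /andP[].
Qed.

Lemma multilinear_mull E (f : _ -> E) w : multilinear f ->
  alternating (tags w) -> multilinear (fun u => f (wmul u w)).
Proof.
move=> fm aw u v i c a b auv /=.
have [su sv] := alt_cat_sorted auv.
have wcat x t w1 : wmul (u ++ x :: t) w1 = wmul u (push x (wmul t w1)).
  by rewrite /wmul foldr_cat.
rewrite !wcat; case: v sv auv => [|y v] sv auv /=.
  case: w aw => [//|[j z] w] aw; have [e|ne] := eqVneq i j.
    case: j / e z aw => z aw; rewrite -/(Tagged A z) !push_same !wmul_catl //.
    by rewrite amulDl amulZl fm //; apply: alt_glue.
  rewrite !push_diff // !wmul_catl // fm //; apply: alt_glue => //=.
  by rewrite ne.
have [z [t E' st]] := @wmul_cons_tag (y :: v) (tag y) (tags v) erefl w.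
move: E' => /= ->; have ne : i != tag y by case/andP: sv.
rewrite !push_diff // !wmul_catl // fm //.
have ay : alternating (tags (y :: v)) by case/andP: sv.
by apply: alt_glue => //=; rewrite ne; exact: st.
Qed.

Lemma push_cat x v w : v != [::] -> push x (v ++ w) = push x v ++ w.
Proof. by case: v => // y v _; rewrite /push /=; case: eqP. Qed.

Lemma wmul_neq0 u v : v != [::] -> wmul u v != [::].
Proof.
case: u => [//|x u] _ /=; have [t [e _]] := tags_push x (wmul u v).
by apply/eqP => e0; rewrite e0 in e.
Qed.

Lemma wmul_cat u v w : v != [::] -> wmul u (v ++ w) = wmul u v ++ w.
Proof.
move=> v0; elim: u => [//|y u IHu] /=.
by rewrite IHu push_cat // wmul_neq0.
Qed.

Lemma wmul_alt_cat u v (w : seq 'I_k) : v != [::] ->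
  alternating (tags v ++ w) -> alternating (tags (wmul u v) ++ w).
Proof.
move=> v0 avw; elim: u => [//|x u IHu] /=; move: IHu (wmul_neq0 u v0).
case: (wmul u v) => [//|y t] ay _; rewrite /push; case: eqP => [e|/eqP ne] //=.
by rewrite altE /= ne; case/andP: ay.
Qed.

Lemma multilinear_mulr E (f : _ -> E) w : multilinear f ->
  alternating (tags w) -> multilinear (fun u => f (wmul w u)).
Proof.
move=> fm aw u v i c a b auv /=.
have [u0|u0] := eqVneq u [::]; last first.
  by rewrite !wmul_cat // fm //; apply: wmul_alt_cat.
rewrite {u}u0 /= in auv *.
case/lastP: w aw => [//|w [j z]] aw; rewrite /wmul -cats1 !foldr_cat -!/(wmul _ _) /=.
move: aw; rewrite /tags map_rcons -cats1 -/(tags w) /= => aw.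
have [sw _] := alt_cat_sorted aw.
have [e|ne] := eqVneq j i.
  case: i / e a b auv => a b auv.
  rewrite -/(Tagged A z) !push_same !wmul_catl // amulDr amulZr fm //.
  by apply: alt_glue.
have gen (t : A i) : wmul w (push (existT _ j z) (Tagged A t :: v)) =
    (rcons w (Tagged A z)) ++ Tagged A t :: v.
  by rewrite push_diff // wmul_catl // -cats1 -catA.
rewrite !gen fm // /tags map_rcons -cats1 -/(tags w) -catA /=.
by apply: alt_glue => //=; rewrite ne.
Qed.

Lemma fs_eval_mull E (f : _ -> E) s t : fs_eval f (fs_mul s t) =
  \sum_(q <- t) q.1 *: fs_eval (fun u => f (wmul u (val q.2))) s.
Proof.
rewrite fs_eval_mul exchange_big /=; apply: eq_bigr => q _.
rewrite /fs_eval scaler_sumr; apply: eq_bigr => p _.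
by rewrite scalerA mulrC.
Qed.

Lemma fs_eval_mulr E (f : _ -> E) s t : fs_eval f (fs_mul s t) =
  \sum_(p <- s) p.1 *: fs_eval (fun u => f (wmul (val p.2) u)) t.
Proof.
rewrite fs_eval_mul; apply: eq_bigr => p _.
by rewrite /fs_eval scaler_sumr; apply: eq_bigr => q _; rewrite scalerA.
Qed.

Lemma tensor_eq_mul s s' t t' : tensor_eq s s' -> tensor_eq t t' ->
  tensor_eq (fs_mul s t) (fs_mul s' t').
Proof.
move=> hs ht E f fm; transitivity (fs_eval f (fs_mul s' t)).
  rewrite !fs_eval_mull; apply: eq_bigr => q _; rewrite hs //.
  exact: multilinear_mull fm (valP q.2).
rewrite !fs_eval_mulr; apply: eq_bigr => p _; rewrite ht //.
exact: multilinear_mulr fm (valP p.2).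
Qed.

Lemma fp_mul_pi s t :
  fp_mul (\pi_free_product s) (\pi_free_product t) = \pi_free_product (fs_mul s t).
Proof. by apply/tensor_pi; apply: tensor_eq_mul; exact: tensor_repr. Qed.

Lemma fp_eval_mull E (f : _ -> E) x y : multilinear f ->
  fp_eval f (fp_mul x y) =
  \sum_(q <- repr y) q.1 *: fp_eval (fun u => f (wmul u (val q.2))) x.
Proof. by move=> fm; rewrite /fp_mul fp_eval_pi // fs_eval_mull. Qed.

Lemma fp_eval_mulr E (f : _ -> E) x y : multilinear f ->
  fp_eval f (fp_mul x y) =
  \sum_(p <- repr x) p.1 *: fp_eval (fun u => f (wmul (val p.2) u)) y.
Proof. by move=> fm; rewrite /fp_mul fp_eval_pi // fs_eval_mulr. Qed.

Lemma fp_mulA : associative fp_mul.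
Proof.
move=> x y z; rewrite -[x]reprK -[y]reprK -[z]reprK.
move: (repr x) (repr y) (repr z) => r s t; rewrite (fp_mul_pi s t) (fp_mul_pi r s) !fp_mul_pi.
apply/tensor_pi => E f fm; rewrite !fs_eval_mul.
rewrite sum_fs_mul; apply: eq_bigr => p _.
rewrite sum_fs_mul; apply: eq_bigr => q _.
by apply: eq_bigr => o _ /=; rewrite mulrA wmulA.
Qed.

Lemma fp_mulDl : left_distributive fp_mul +%R.
Proof.
move=> x y z; apply: fp_evalP => E f fm; rewrite fp_evalD // !fp_eval_mull //.
rewrite -big_split; apply: eq_bigr => q _ /=; rewrite fp_evalD ?scalerDr //.
exact: multilinear_mull fm (valP q.2).
Qed.

Lemma fp_mulDr : right_distributive fp_mul +%R.
Proof.
move=> x y z; apply: fp_evalP => E f fm; rewrite fp_evalD // !fp_eval_mulr //.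
rewrite -big_split; apply: eq_bigr => q _ /=; rewrite fp_evalD ?scalerDr //.
exact: multilinear_mulr fm (valP q.2).
Qed.

Lemma fp_mulZl c x y : fp_mul (c *: x) y = c *: fp_mul x y.
Proof.
apply: fp_evalP => E f fm; rewrite fp_evalZ // !fp_eval_mull // scaler_sumr.
apply: eq_bigr => q _ /=; rewrite fp_evalZ ?scalerA 1?mulrC //.
exact: multilinear_mull fm (valP q.2).
Qed.

Lemma fp_mulZr c x y : fp_mul x (c *: y) = c *: fp_mul x y.
Proof.
apply: fp_evalP => E f fm; rewrite fp_evalZ // !fp_eval_mulr // scaler_sumr.
apply: eq_bigr => q _ /=; rewrite fp_evalZ ?scalerA 1?mulrC //.
exact: multilinear_mulr fm (valP q.2).
Qed.

HB.instance Definition _ := Lmodule_isAssocAlgebra.Build K free_product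
  fp_mulA fp_mulDl fp_mulDr fp_mulZl fp_mulZr.

Definition pt_class (w : pure_tensor) : free_product := \pi_free_product [:: (1, w)].

Definition fp_in i (a : A i) : free_product :=
  pt_class (exist _ [:: Tagged A a] isT).

Definition tensor_word (e : seq 'I_k)
    (a : forall l : 'I_(size e), A (tnth (in_tuple e) l)) : seq factor :=
  [seq Tagged A (a l) | l <- enum 'I_(size e)].

Lemma tags_tensor_word e a : tags (@tensor_word e a) = e.
Proof.
rewrite /tags /tensor_word -map_comp.
exact: (map_tnth_enum (in_tuple e)).
Qed.

Lemma alternating_tensor_word (e : altseq k) a :
  alternating (tags (@tensor_word e a)).
Proof. by rewrite tags_tensor_word; exact: altvalP. Qed.

Definition tensor (e : altseq k)
    (a : forall l : 'I_(size e), A (tnth (in_tuple e) l)) : free_product :=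
  pt_class (exist _ (tensor_word a) (alternating_tensor_word a)).

Lemma fp_evalE E (f : seq factor -> E) w : multilinear f ->
  fp_eval f (pt_class w) = f (val w).
Proof.
by move=> fm; rewrite /pt_class fp_eval_pi // /fs_eval big_seq1 scale1r.
Qed.

Lemma pt_class_mul u v :
  amul (pt_class u) (pt_class v) = pt_class (pt_mul u v).
Proof. by rewrite /pt_class [LHS]fp_mul_pi /fs_mul /= mulr1. Qed.

Lemma fp_in_linear i : linear (@fp_in i).
Proof.
move=> c a b; apply: fp_evalP => E f fm.
rewrite fp_eval_linear // !fp_evalE //=.
exact: (fm [::] [::] i c a b).
Qed.

Lemma fp_inM i : {morph @fp_in i : a b / amul a b}.
Proof.
move=> a b; rewrite /fp_in pt_class_mul; congr pt_class.
by apply: val_inj; rewrite /= push_same.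
Qed.

Definition fp_in_lin i : {linear A i -> free_product} :=
  HB.pack (@fp_in i) (GRing.isLinear.Build K (A i) free_product *:%R (@fp_in i)
    (@fp_in_linear i)).

Definition fp_inj i : alg_hom (A i) free_product :=
  @AlgHom K (A i) free_product (fp_in_lin i) (@fp_inM i).

Section Lift.
Variables (B : assocAlgType K) (f : forall i, alg_hom (A i) B).

Definition factor_lift (x : factor) : B := f (tag x) (tagged x).

Fixpoint word_lift (w : seq factor) : B :=
  match w with
  | [::] => 0
  | [:: x] => factor_lift x
  | x :: v => amul (factor_lift x) (word_lift v)
  end.

Lemma word_lift_cons x v : v != [::] ->
  word_lift (x :: v) = amul (factor_lift x) (word_lift v).
Proof. by case: v. Qed.

Lemma word_lift_multilinear : multilinear word_lift.
Proof.
move=> u v i c a b _; elim: u => [|x u IHu] /=.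
  have fl : factor_lift (Tagged A (c *: a + b)) =
      c *: factor_lift (Tagged A a) + factor_lift (Tagged A b).
    by rewrite /factor_lift linearP.
  by case: v => [|y v]; rewrite fl // amulDl amulZl.
have cat0 t : u ++ Tagged A t :: v != [::] by case: (u).
by rewrite -!/(word_lift (_ :: _)) !word_lift_cons // IHu amulDr amulZr.
Qed.

Lemma word_lift_push x v : v != [::] ->
  word_lift (push x v) = amul (factor_lift x) (word_lift v).
Proof.
case: v => // y v _; have [e|ne] := eqVneq (tag x) (tag y); last first.
  by rewrite push_diff.
case: x y e => i a [j b] /= e; case: j / e b => b.
rewrite -/(Tagged A b) -/(Tagged A a) push_same.
have fl : factor_lift (Tagged A (amul a b)) =
    amul (factor_lift (Tagged A a)) (factor_lift (Tagged A b)).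
  by rewrite /factor_lift homM.
by case: v => [|y v]; rewrite /= fl // -amulA.
Qed.

Lemma word_lift_mul u v : u != [::] -> v != [::] ->
  word_lift (wmul u v) = amul (word_lift u) (word_lift v).
Proof.
move=> u0 v0; elim: u u0 => [//|x u IHu] _.
have [->|u0] := eqVneq u [::]; first by rewrite [wmul _ _]/= word_lift_push.
rewrite [wmul _ _]/= -/(wmul u v) word_lift_push ?wmul_neq0 //.
by rewrite IHu // word_lift_cons // amulA.
Qed.

Definition fp_lift_lin : {linear free_product -> B} :=
  HB.pack (fp_eval word_lift) (GRing.isLinear.Build K free_product B *:%R
    (fp_eval word_lift) (fp_eval_linear word_lift_multilinear)).

Lemma pure_tensor_neq0 (w : pure_tensor) : val w != [::].
Proof. by case: w => -[]. Qed.

Lemma fp_liftM : {morph fp_lift_lin : x y / amul x y}.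
Proof.
move=> x y; rewrite /= -[x]reprK -[y]reprK.
move: (repr x) (repr y) => s t; rewrite [amul _ _]fp_mul_pi.
rewrite !fp_eval_pi; try exact: word_lift_multilinear.
rewrite fs_eval_mul /fs_eval.
have amul_suml (r : formal_sum) (F : K * pure_tensor -> B) z :
    amul (\sum_(p <- r) F p) z = \sum_(p <- r) amul (F p) z.
  elim: r => [|p r IHr]; last by rewrite !big_cons amulDl IHr.
  by rewrite !big_nil -[in LHS](scale0r z) amulZl scale0r.
have amul_sumr (r : formal_sum) (F : K * pure_tensor -> B) z :
    amul z (\sum_(p <- r) F p) = \sum_(p <- r) amul z (F p).
  elim: r => [|p r IHr]; last by rewrite !big_cons amulDr IHr.
  by rewrite !big_nil -[in LHS](scale0r z) amulZr scale0r.
rewrite amul_suml; apply: eq_bigr => p _; rewrite amul_sumr.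
apply: eq_bigr => q _; rewrite amulZl amulZr scalerA.
by rewrite word_lift_mul ?pure_tensor_neq0.
Qed.

Definition fp_lift : alg_hom free_product B := AlgHom fp_liftM.

Lemma fp_lift_in i a : fp_lift (fp_in a) = f i a.
Proof. by rewrite /= fp_evalE //; exact: word_lift_multilinear. Qed.

Lemma fp_lift_pt (g : alg_hom free_product B) :
  (forall i (a : A i), g (fp_in a) = f i a) ->
  forall w, g (pt_class w) = word_lift (val w).
Proof.
move=> gf [w aw] /=; elim: w aw => [//|[i a] w IHw] aw.
case: w => [|y w] in IHw aw *.
  rewrite -/(Tagged A a) /= -[RHS](gf i a) /fp_in; congr (g (pt_class _)).
  exact: val_inj.
have aw' : alternating (tags (y :: w)).
  by move: aw; rewrite !altE /= => /andP[].
rewrite word_lift_cons // -(IHw aw') -[factor_lift _]gf -homM pt_class_mul.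
congr (g (pt_class _)); apply: val_inj; rewrite /= push_diff //.
by move: aw; rewrite altE /= => /andP[].
Qed.

Lemma fp_lift_unique (g : alg_hom free_product B) :
  (forall i (a : A i), g (fp_in a) = f i a) -> g =1 fp_lift.
Proof.
move=> gf x; rewrite -[x]reprK; move: (repr x) => {x} s.
have -> : \pi_free_product s = \sum_(p <- s) p.1 *: pt_class p.2.
  apply: fp_evalP => E h hm; rewrite fp_eval_pi //.
  elim: s => [|p s IHs].
    by rewrite big_nil /fs_eval big_nil fp_eval0.
  by rewrite big_cons /fs_eval big_cons fp_evalD // -IHs fp_evalZ // fp_evalE.
rewrite !linear_sum; apply: eq_bigr => p _.
rewrite !linearZ fp_lift_pt //= fp_evalE //; exact: word_lift_multilinear.
Qed.

End Lift.

End FreeProduct.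

Arguments tensor {K k A} e a.

Section FreeProductMap.
Variables (K : fieldType) (k : nat) (A B : 'I_k -> assocAlgType K).
Variable (j : forall i, alg_hom (B i) (A i)).

Lemma fp_map_homM i :
  {morph (fp_inj A i \o j i : {linear B i -> free_product A}) : x y / amul x y}.
Proof. by move=> x y /=; rewrite homM fp_inM. Qed.

Definition fp_map : alg_hom (free_product B) (free_product A) :=
  fp_lift (fun i => AlgHom (@fp_map_homM i)).

End FreeProductMap.

Definition functionals (K : fieldType) (d : nat) (A : lmodType K) :=
  'I_d -> {scalar A}.

Definition pullback (K : fieldType) (d : nat) (A B : assocAlgType K)
    (phi : functionals d A) (j : alg_hom B A) : functionals d B :=
  fun l => phi l \o j.

Definition family_product (K : fieldType) (d k : nat) :=
  forall A : 'I_k -> assocAlgType K,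
    (forall i, functionals d (A i)) -> functionals d (free_product A).

Definition degenerate (K : fieldType) (d k : nat) (prod : family_product K d k) :=
  forall (A : 'I_k -> assocAlgType K) (phi : forall i, functionals d (A i))
    (e : altseq k) (a : forall l : 'I_(size e), A (tnth (in_tuple e) l)),
    (1 < size e)%N -> forall l, prod A phi l (tensor e a) = 0.

Record universal_product (K : fieldType) (d k : nat) := UniversalProduct {
  uprod : family_product K d k;
  uprod_universal :
    forall (A B : 'I_k -> assocAlgType K) (phi : forall i, functionals d (A i))
      (j : forall i, alg_hom (B i) (A i)) (l : 'I_d) (x : free_product B),
      uprod phi l (fp_map j x) = uprod (fun i => pullback (phi i) (j i)) l x;
  uprod_nondegenerate : k = 2%N -> ~ degenerate uprod
}.

(* The free semigroup on X: (x, s) is the nonempty word x :: s. *)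
Definition fsg (X : Type) : Type := (X * seq X)%type.

Definition letters (X : Type) (M : fsg X) : seq X := M.1 :: M.2.

Definition subst (K : fieldType) (A : assocAlgType K) (X : Type) (a : X -> A)
    (M : fsg X) : A :=
  foldl (@amul K A) (a M.1) [seq a x | x <- M.2].

Section Mset.
Local Open Scope mset_scope.
Local Open Scope nat_scope.
Variables (d : nat) (X : finType).

Definition word_set (M : fsg X) : {set X} := [set x in letters M].

(* Elements of the free commutative monoid on a set are multisets; as a list, a
   multiset enumerates its factors with their multiplicities. *)
Definition inM (pi : {mset fsg X}) : bool :=
  [&& \sum_(M <- pi) size (letters M) == #|X|,
      pairwise (fun M N => [disjoint word_set M & word_set N]) pi
    & all (fun M => #|word_set M| == size (letters M)) pi].

Definition inMd (pi : {mset fsg X * 'I_d}) : bool :=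
  inM (seq_mset [seq p.1 | p <- pi]).

End Mset.

Section Expansion.
Local Open Scope mset_scope.
Local Open Scope classical_set_scope.
Variables (K : fieldType) (d k : nat) (e : altseq k).

(* X^(i), the variable x_l being represented by its index l (from 0). *)
Definition colour (i : 'I_k) : finType :=
  {l : 'I_(size e) | tnth (in_tuple e) l == i}.

Definition mset_family :=
  {dffun forall i : 'I_k, {mset fsg (colour i) * 'I_d}}.

(* A tuple (pi_1, ..., pi_k) with pi_i in M_d(X^(i)); the nested sums over the
   pi_i become one sum over this set, finite by finite_Md_family below. *)
Definition Md_family : set mset_family :=
  [set pi : mset_family | forall i, inMd (pi i)].

Section Values.
Variables (A : 'I_k -> assocAlgType K) (phi : forall i, functionals d (A i)).
Variable a : forall l : 'I_(size e), A (tnth (in_tuple e) l).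

(* a_l as an element of A_i, for x_l in X^(i). *)
Definition colour_factor (i : 'I_k) (x : colour i) : A i :=
  ecast i (A i) (eqP (valP x)) (a (val x)).

Definition moment (pi : mset_family) : K :=
  \prod_(i < k) \prod_(p <- pi i) phi i p.2 (subst (@colour_factor i) p.1).

End Values.

Definition is_expansion (odot : universal_product K d k)
    (alpha : mset_family -> 'rV[K]_d) : Prop :=
  forall (A : 'I_k -> assocAlgType K) (phi : forall i, functionals d (A i))
    (a : forall l : 'I_(size e), A (tnth (in_tuple e) l)),
    \row_l uprod odot phi l (tensor e a) =
    \sum_(pi \in Md_family) moment phi a pi *: alpha pi.

End Expansion.

Arguments Md_family d {k} e.
Arguments is_expansion {K d k} e odot alpha.

Section Finiteness.
Local Open Scope mset_scope.
Local Open Scope nat_scope.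
Fixpoint bseqs (T : Type) (L : seq T) (n : nat) : seq (seq T) :=
  if n is m.+1 then [::] :: [seq x :: s | x <- L, s <- bseqs L m] else [:: [::]].

Lemma mem_bseqs (T : eqType) (L : seq T) n s :
  size s <= n -> all (fun x => x \in L) s -> s \in bseqs L n.
Proof.
elim: n s => [|n IHn] [|x s] //= sn /andP[xL sL].
by rewrite inE /=; apply: allpairs_f => //; exact: IHn.
Qed.

Definition Md_seq d (X : finType) : seq {mset fsg X * 'I_d} :=
  [seq seq_mset s | s <- bseqs
    [seq (w, l) | w <- [seq (x, s) | x <- enum X, s <- bseqs (enum X) #|X|],
                  l <- enum 'I_d] #|X|].

Lemma mem_Md_seq d (X : finType) (pi : {mset fsg X * 'I_d}) : inMd pi -> pi \in Md_seq d X.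
Proof.
case/and3P => /eqP sz _ _; rewrite -[pi]seq_mset_id; apply: map_f.
rewrite (perm_big _ (perm_eq_seq_mset _)) big_map in sz.
apply: mem_bseqs.
  by rewrite -sz -sum1_size; apply: leq_sum => p _.
apply/allP => -[[x s] l] ppi.
have ss : size s <= #|X|.
  by rewrite -sz (big_rem _ ppi) /= (leq_trans _ (leq_addr _ _)).
apply: allpairs_f; last by rewrite mem_enum.
apply: allpairs_f; first by rewrite mem_enum.
by apply: mem_bseqs => //; apply/allP => y _; rewrite mem_enum.
Qed.
End Finiteness.

Lemma finite_Md_family d k (e : altseq k) : finite_set (Md_family d e).
Proof.
pose L i := Md_seq d (colour e i); pose N := (\sum_(i < k) size (L i))%N.
pose g (h : {ffun 'I_k -> 'I_N.+1}) : mset_family d e :=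
  [ffun i => nth mset0 (L i) (h i)].
apply: (@sub_finite_set _ _ (range g)); last exact: finite_image.
move=> pi piM; exists [ffun i => inord (index (pi i) (L i))] => //.
apply/ffunP => i; have piL : pi i \in L i by exact/mem_Md_seq/piM.
rewrite !ffunE inordK ?nth_index // ltnS.
by apply: leq_trans (index_size _ _) _; rewrite /N (bigD1 i) /= ?leq_addr.
Qed.

(* Main.v *)
Require Import Defs.
From HB Require Import structures.
From mathcomp Require Import all_boot all_order all_algebra finmap multiset.
From mathcomp Require Import boolp classical_sets cardinality fsbigop.
From mathcomp Require Import complex reals.
From mathcomp.multinomials Require Import freeg.

(** By universality, the value of the product on a_1 ... a_n is its value on
   x_1 ... x_n in the free algebras on the X^(i), for the functionals psi sending a
   word to the corresponding moment of the a_l; call it F psi. Rescaling x_l by c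
   multiplies F by c, and the moment of a word of degree m in x_l by c ^ m. Writing
   x_l = (x_l, 0) + (0, x_l) in the square of the free algebras and using
   multilinearity, F is additive in the part of psi living on the words that contain
   x_l, the rest of psi being fixed. Together these force F to ignore words with
   repeated letters, so that F is a polynomial in finitely many moments, linear in
   those that contain any given letter: only the monomials whose words use every
   letter exactly once survive. The coefficient of such a monomial pi is the value
   of F at the indicator function of the factors of pi. *)

Set Implicit Arguments.
Unset Strict Implicit.
Unset Printing Implicit Defensive.

Import Order.TTheory GRing.Theory Num.Theory.

Local Open Scope ring_scope.
Local Open Scope mset_scope.

(** * Functions of moments that are additive and homogeneous in each letter *)

Lemma count_ltn (T : eqType) (a b : pred T) (s : seq T) x : x \in s ->
  ~~ a x -> b x -> subpred a b -> (count a s < count b s)%N.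
Proof.
move=> + nax bx ab; elim: s => //= y s IHs; rewrite inE => /orP[/eqP <-|/IHs lt].
  by rewrite (negPf nax) bx add0n add1n ltnS sub_count.
rewrite -addnS leq_add //; by case: (boolP (a y)) => // /ab ->.
Qed.

Section LetterwiseDefs.
Variables (K : pzRingType) (L : finType) (T : eqType) (w : T -> seq L).
Implicit Types (G : (T -> K) -> K) (psi : T -> K) (S : pred T).

(** Here [T] indexes moments, [w q] is the word of [q] and [psi] prescribes the values. This is
    additivity in [x_l] seen on moments: those without [l] are common parameters, those with [l] are
    split. *)
Definition letterwise_additive G := forall l psi1 psi2 psi,
  (forall q, l \notin w q -> psi1 q = psi q /\ psi2 q = psi q) ->
  (forall q, l \in w q -> psi q = psi1 q + psi2 q) ->
  G psi = G psi1 + G psi2.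

Definition letterwise_homogeneous G := forall l c psi,
  G (fun q => c ^+ count_mem l (w q) * psi q) = c * G psi.

(** Such an [S] picks out the factors of a tuple of multisets: each letter lies in exactly one word
    and occurs there once. *)
Definition exact_cover S :=
  (forall q, S q -> uniq (w q)) /\
  (forall l, exists2 q, S q /\ l \in w q &
     forall q', S q' -> l \in w q' -> q' = q).

End LetterwiseDefs.

Section Letterwise.
Variables (K : numFieldType) (L : finType) (T : eqType) (w : T -> seq L).
Implicit Types (psi : T -> K) (S : pred T).
Variable G : (T -> K) -> K.
Hypothesis (addG : letterwise_additive w G) (homG : letterwise_homogeneous w G).

(** Such a [psi] splits along [l] as itself plus itself, so [G psi = G psi + G psi]. *)
Lemma letterwise_uncovered l psi :
  (forall q, l \in w q -> psi q = 0) -> G psi = 0.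
Proof.
move=> h; have := addG (l := l) (psi1 := psi) (psi2 := psi) (psi := psi).
move=> /(_ (fun _ _ => conj erefl erefl)) /(_ _)/eqP.
rewrite -subr_eq subrr eq_sym => H; apply/eqP/H.
by move=> q /h ->; rewrite addr0.
Qed.

Lemma expr2_sub2_neq0 m : m != 1%N -> 2 ^+ m - 2 != 0 :> K.
Proof.
move=> m1; rewrite subr_eq0 -natrX eqr_nat -[X in _ == X]expn1.
by rewrite eqn_exp2l.
Qed.

Definition keep (P : pred T) psi : T -> K := fun q => if P q then psi q else 0.

(* Words in which [l] is repeated are irrelevant: doubling [x_l] doubles [G] but
   multiplies their moments by [2 ^ m] with [m != 1]. *)
Lemma letterwise_repeated l psi :
  (forall q, l \in w q -> count_mem l (w q) = 1%N -> psi q = 0) -> G psi = 0.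
Proof.
move=> h.
(* [chi] solves [2 ^ m * chi = psi + 2 * chi] on words in which [l] occurs [m > 0] times; for
   [m = 1] the denominator is [0], but there [psi] vanishes. As [psi2] doubles [chi] on these words
   only, one gets [2 * G chi = G psi + 2 * G chi]. *)
pose chi q := if l \in w q then psi q / (2 ^+ count_mem l (w q) - 2) else psi q.
pose psi2 q := 2 * (if l \in w q then chi q else psi q / 2).
have chi0 q : l \notin w q -> chi q = psi q by rewrite /chi => /negPf ->.
have := homG l 2 chi.
rewrite (addG (l := l) (psi1 := psi) (psi2 := psi2)); first last.
- move=> q lq; rewrite /psi2 /chi lq; have [c1|c1] := eqVneq (count_mem l (w q)) 1%N.
    by rewrite h // mul0r !mulr0 addr0.
  have nz := expr2_sub2_neq0 c1; apply/eqP; rewrite -subr_eq -mulrBl.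
  by rewrite mulrC divfK.
- move=> q lq; rewrite /psi2 (negPf lq) chi0 // (count_memPn lq) expr0 mul1r.
  by rewrite mulrC divfK // pnatr_eq0.
rewrite (addG (l := l) (psi1 := chi) (psi2 := chi) (psi := psi2)).
- by rewrite mulr_natl mulr2n => /(canRL (addrK _)); rewrite subrr.
- move=> q lq; rewrite /psi2 (negPf lq) chi0 //; split=> //;
  by rewrite mulrC divfK // pnatr_eq0.
- by move=> q lq; rewrite /psi2 lq mulr_natl mulr2n.
Qed.

Lemma letterwise_keep_count1 l psi :
  G psi = G (keep (fun q => count_mem l (w q) <= 1)%N psi).
Proof.
(* On words without [l] the count is [0] and satisfies both conditions, so both parts keep [psi]
   there, as additivity demands. *)
rewrite (addG (l := l) (psi := psi)
  (psi1 := keep (fun q => count_mem l (w q) <= 1)%N psi)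
  (psi2 := keep (fun q => count_mem l (w q) != 1)%N psi)).
- rewrite [X in _ + X](letterwise_repeated (l := l)) ?addr0 //.
  by move=> q _ c1; rewrite /keep c1.
- by move=> q lq; rewrite /keep (count_memPn lq).
- move=> q lq; have : (0 < count_mem l (w q))%N by rewrite -has_count has_pred1.
  by rewrite /keep; case: (count_mem _ _) => [|[|m]] //= _; rewrite ?addr0 ?add0r.
Qed.

Lemma letterwise_keep_uniq psi : G psi = G (keep (fun q => uniq (w q)) psi).
Proof.
have -> : keep (fun q => uniq (w q)) psi =
    keep (fun q => all (fun l => count_mem l (w q) <= 1)%N (enum L)) psi.
  apply/funext => q; rewrite /keep; congr (if _ then _ else _).
  apply/idP/allP => [u l _|h]; first by rewrite count_uniq_mem // leq_b1.
  apply: count_mem_uniq => l; have := h l (mem_enum _ _).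
  rewrite -has_pred1 has_count; by case: count => [|[|]].
elim: (enum L) => [|l s IHs] //=.
rewrite IHs (letterwise_keep_count1 l); congr G; apply/funext => q.
by rewrite /keep /=; case: ifP.
Qed.

Variable D : seq T.
Hypothesis (uniqD : forall q, uniq (w q) -> q \in D) (w0 : forall q, w q != [::]).

(* If only [q] contains the letter [l], rescaling [x_l] by [psi q] reduces to the
   case [psi q = 1]. *)
Lemma letterwise_set1 psi :
  (forall l q q', psi q != 0 -> psi q' != 0 -> l \in w q -> l \in w q' -> q = q') ->
  (forall q, psi q != 0 -> uniq (w q)) ->
  G (fun q => (psi q != 0)%:R) = 0 -> G psi = 0.
Proof.
move=> inj un G1.
(* The nonzero values are normalised to [1] one index at a time, [s] listing the indices already
   treated; [D] exhausts the support. *)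
have: forall s : seq T, G (fun q => if q \in s then (psi q != 0)%:R else psi q) = 0 ->
    G psi = 0.
  elim=> [//|q0 s IHs] Gs; have [q0s|q0s] := boolP (q0 \in s).
    apply: IHs; rewrite -[RHS]Gs; congr G; apply/funext => q.
    by rewrite inE; have [->|] := eqVneq q q0; rewrite ?q0s.
  have [z|nz] := eqVneq (psi q0) 0.
    apply: IHs; rewrite -[RHS]Gs; congr G; apply/funext => q.
    by rewrite inE; have [->|] := eqVneq q q0; rewrite ?(negPf q0s) ?z ?eqxx.
  have [l lq0] : exists l, l \in w q0.
    by case: (w q0) (w0 q0) => // l r _; exists l; rewrite inE eqxx.
  apply: IHs; transitivity (psi q0 * 0); last by rewrite mulr0.
  rewrite -{2}Gs -(homG l); congr G; apply/funext => q; rewrite inE.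
  have [->|neq] := eqVneq q q0.
    by rewrite (negPf q0s) nz mulr1 count_uniq_mem ?un // lq0 expr1.
  have [z|nzq] := eqVneq (psi q) 0; first by rewrite z /= !if_same mulr0.
  have lq : l \notin w q by apply: contraNN neq => lq; rewrite (inj l q q0).
  by rewrite (count_memPn lq) expr0 mul1r.
move/(_ D); apply.
rewrite -[RHS]G1; congr G; apply/funext => q; case: ifP => // qD.
have [->|nz] := eqVneq (psi q) 0 => //.
by rewrite uniqD // un in qD.
Qed.

(** Induction on the number of nonzero values, which is finite because [D] contains all
    repetition-free words. Once no two words of the support share a letter, either some letter is
    uncovered or the support is an exact cover. *)
Lemma letterwise_eq0 :
  (forall S, exact_cover w S -> G (fun q => (S q)%:R) = 0) -> forall psi, G psi = 0.
Proof.
move=> G1 psi; rewrite letterwise_keep_uniq.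
have: forall q, keep (fun q => uniq (w q)) psi q != 0 -> uniq (w q).
  by move=> q; rewrite /keep; case: ifP => //; rewrite eqxx.
move: (keep _ _) => {}psi.
have [n] := ubnP (count (fun q => psi q != 0) D).
elim: n psi => // n IHn psi; rewrite ltnS => len un.
have [[l [q [q' [nz nz' lq lq' neq]]]]|ninj] := pselect (exists l q q',
    [/\ psi q != 0, psi q' != 0, l \in w q, l \in w q' & q != q']).
  (* Among the words through the shared letter [l], the first part keeps only [q] and so loses [q'],
     while the second loses [q]: both supports shrink. *)
  rewrite (addG (l := l) (psi := psi)
    (psi1 := keep (fun x => (l \in w x) ==> (x == q)) psi)
    (psi2 := keep (fun x => x != q) psi)).
  - have z (P : pred T) x : psi x != 0 -> ~~ P x -> G (keep P psi) = 0.
      move=> nx Px; have kP y : keep P psi y != 0 -> psi y != 0.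
        by rewrite /keep; case: ifP => //; rewrite eqxx.
      apply: IHn => [|y /kP]; last exact: un.
      apply: leq_trans len; apply: (count_ltn (uniqD (un x nx))) => //.
      by rewrite /keep (negPf Px) eqxx.
    rewrite (z _ q') // ?(z _ q) ?addr0 // ?eqxx //.
    by rewrite lq' eq_sym (negPf neq).
  - move=> x lx; rewrite /keep (negPf lx) /=; split=> //; case: eqP => // xq.
    by rewrite xq lq in lx.
  - by move=> x lx; rewrite /keep lx /=; case: eqP; rewrite ?addr0 ?add0r.
have inj l q q' : psi q != 0 -> psi q' != 0 -> l \in w q -> l \in w q' -> q = q'.
  move=> *; apply: contrapT => /eqP neq; apply: ninj.
  by exists l, q, q'.
have [[l lP]|cov] := pselect (exists l, forall q, l \in w q -> psi q = 0).
  exact: (letterwise_uncovered lP).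
apply: letterwise_set1 => //; apply: G1; split=> // l.
have [[q [nz lq]]|no] := pselect (exists q, psi q != 0 /\ l \in w q).
  by exists q => // q' nz' lq'; apply: (inj l).
case: cov; exists l => q lq; apply: contrapT => /eqP nz; apply: no.
by exists q.
Qed.

End Letterwise.

(** * The free algebra *)

Section FreeAlgebra.
Variables (K : fieldType) (X : choiceType).
Implicit Types (E : lmodType K) (u v : fsg X).

Definition free_alg := {freeg (fsg X) / K}.

HB.instance Definition _ := GRing.Lmodule.on free_alg.

Implicit Types (x y z : free_alg).

Definition monomial u : free_alg := << u >>.

Definition extend E (f : fsg X -> E) x : E := \sum_(u <- dom x) coeff u x *: f u.

Lemma extend_monomial E (f : fsg X -> E) u : extend f (monomial u) = f u.
Proof. by rewrite /extend domU1 big_seq1 coeffU eqxx mulr1 scale1r. Qed.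

Lemma extend_big_subset E (f : fsg X -> E) x (s : seq (fsg X)) : uniq s ->
  {subset dom x <= s} -> extend f x = \sum_(u <- s) coeff u x *: f u.
Proof.
move=> us sub; rewrite [RHS](bigID (fun u => u \in dom x)) /=.
rewrite [X in _ = _ + X]big1 => [|u /coeff_outdom ->]; last by rewrite scale0r.
rewrite addr0 -[RHS]big_filter; apply/perm_big/uniq_perm;
  rewrite ?filter_uniq ?uniq_dom //.
by move=> u; rewrite mem_filter; case: (boolP (u \in dom x)) => // /sub ->.
Qed.

Lemma extend_linear E (f : fsg X -> E) : linear (extend f).
Proof.
move=> c x y; pose s := undup (dom x ++ dom y ++ dom (c *: x + y)).
rewrite !(@extend_big_subset _ _ _ s) ?undup_uniq //.
- rewrite scaler_sumr -big_split; apply: eq_bigr => u _ /=.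
  by rewrite coeffD coeffZ scalerDl scalerA.
- by move=> u; rewrite mem_undup !mem_cat => ->; rewrite !orbT.
- by move=> u; rewrite mem_undup !mem_cat => ->.
- by move=> u; rewrite mem_undup !mem_cat => ->; rewrite !orbT.
Qed.

Lemma extend_fun_linear E c (f g : fsg X -> E) x :
  extend (fun u => c *: f u + g u) x = c *: extend f x + extend g x.
Proof.
rewrite scaler_sumr -big_split; apply: eq_bigr => u _ /=.
by rewrite scalerDr !scalerA mulrC.
Qed.

Definition extend_lin E (f : fsg X -> E) : {linear free_alg -> E} :=
  HB.pack (extend f) (GRing.isLinear.Build K free_alg E *:%R (extend f)
    (extend_linear f)).

(** Words span the algebra. Linearity is a predicate here, so that the lemma applies directly to
    expressions such as a product with one argument fixed. *)
Lemma free_alg_ext E (f g : free_alg -> E) : linear f -> linear g ->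
  (forall u, f (monomial u) = g (monomial u)) -> f =1 g.
Proof.
move=> flin glin fg x.
have lin0 (h : free_alg -> E) : linear h -> h 0 = 0.
  move=> /(_ (-1) 0 0); rewrite scaler0 addr0 scaleN1r => h0.
  by rewrite [LHS]h0 addNr.
rewrite -[x]freeg_sumE; elim: (dom x) => [|u s IHs]; first by rewrite big_nil !lin0.
rewrite big_cons; have -> : << coeff u x *g u >> = coeff u x *: monomial u.
  by apply/eqP/freeg_eqP => v; rewrite coeffZ !coeffU mul1r.
by rewrite flin glin fg IHs.
Qed.

Definition fsg_cat u v : fsg X := (u.1, u.2 ++ letters v).

Lemma fsg_catA : associative fsg_cat.
Proof. by move=> u v t; rewrite /fsg_cat /= -catA. Qed.

Definition fa_mul x y : free_alg :=
  extend (fun u => extend (fun v => monomial (fsg_cat u v)) y) x.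

Lemma fa_mulDZl c x y z : fa_mul (c *: x + y) z = c *: fa_mul x z + fa_mul y z.
Proof. exact: extend_linear. Qed.

Lemma fa_mulDZr c x y z : fa_mul z (c *: x + y) = c *: fa_mul z x + fa_mul z y.
Proof.
rewrite -extend_fun_linear; apply: eq_bigr => u _.
by rewrite extend_linear.
Qed.

Lemma fa_mul_monomial u v : fa_mul (monomial u) (monomial v) = monomial (fsg_cat u v).
Proof. by rewrite /fa_mul !extend_monomial. Qed.

Lemma fa_mulA : associative fa_mul.
Proof.
move=> x y z; move: x.
apply: free_alg_ext => [c x t|c x t|u]; rewrite ?fa_mulDZl //.
move: y; apply: free_alg_ext => [c y t|c y t|v]; rewrite ?(fa_mulDZl, fa_mulDZr) //.
move: z; apply: free_alg_ext => [c z t|c z t|t]; rewrite ?fa_mulDZr //.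
by rewrite !fa_mul_monomial fsg_catA.
Qed.

Lemma fa_mulDl : left_distributive fa_mul +%R.
Proof. by move=> x y z; rewrite -[x]scale1r fa_mulDZl !scale1r. Qed.

Lemma fa_mulDr : right_distributive fa_mul +%R.
Proof. by move=> z x y; rewrite -[x]scale1r fa_mulDZr !scale1r. Qed.

Lemma fa_mul0l z : fa_mul 0 z = 0.
Proof. exact: (linear0 (extend_lin _)). Qed.

Lemma fa_mul0r z : fa_mul z 0 = 0.
Proof. by rewrite -[0 in LHS](addNr 0) -scaleN1r fa_mulDZr scaleN1r addNr. Qed.

Lemma fa_mulZl c x y : fa_mul (c *: x) y = c *: fa_mul x y.
Proof. by rewrite -[c *: x]addr0 fa_mulDZl fa_mul0l addr0. Qed.

Lemma fa_mulZr c x y : fa_mul x (c *: y) = c *: fa_mul x y.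
Proof. by rewrite -[c *: y]addr0 fa_mulDZr fa_mul0r addr0. Qed.

HB.instance Definition _ := Lmodule_isAssocAlgebra.Build K free_alg
  fa_mulA fa_mulDl fa_mulDr fa_mulZl fa_mulZr.

Definition gen (a : X) : free_alg := monomial (a, [::]).

Section Lift.
Variables (A : assocAlgType K) (a : X -> A).

Lemma subst_cat u v : subst a (fsg_cat u v) = amul (subst a u) (subst a v).
Proof.
case: u v => [b s] [c t]; rewrite /subst /= map_cat foldl_cat /=.
have foldlM (p q : A) r : foldl amul (amul p q) r = amul p (foldl amul q r).
  by elim: r q => //= z r IHr q; rewrite -amulA IHr.
exact: foldlM.
Qed.

Lemma fa_liftM : {morph extend_lin (subst a) : x y / amul x y}.
Proof.
have mlin (f : {linear free_alg -> A}) (z : A) : linear (fun x => amul (f x) z).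
  by move=> c x y; rewrite linearP amulDl amulZl.
have mlin' (f : {linear free_alg -> A}) (z : A) : linear (fun x => amul z (f x)).
  by move=> c x y; rewrite linearP amulDr amulZr.
move=> x y; move: x; apply: free_alg_ext => [c x z||u].
- by rewrite amulDl amulZl linearP.
- exact: mlin.
move: y; apply: free_alg_ext => [c x z||v].
- by rewrite amulDr amulZr linearP.
- exact: mlin'.
by rewrite [amul _ _]fa_mul_monomial /= !extend_monomial subst_cat.
Qed.

Definition fa_lift : alg_hom free_alg A := AlgHom fa_liftM.

Lemma fa_lift_monomial u : fa_lift (monomial u) = subst a u.
Proof. exact: extend_monomial. Qed.

End Lift.

Lemma subst_scaled_gen (c : X -> K) u :
  subst (fun a => c a *: gen a) u = (\prod_(a <- letters u) c a) *: monomial u.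
Proof.
case: u => a s; rewrite /subst /letters /= big_cons.
elim/last_ind: s => [|s b IHs]; first by rewrite /= big_nil mulr1.
rewrite map_rcons -cats1 foldl_cat /= IHs -cats1 big_cat big_seq1 /=.
rewrite amulZl amulZr scalerA mulrA; congr (_ *: _).
by rewrite [amul _ _]fa_mul_monomial /fsg_cat.
Qed.

End FreeAlgebra.

(** * Values of a universal product *)

Section ProductAlgebra.
Variables (K : fieldType) (A B : assocAlgType K).

(** In the direct product words evaluate componentwise, so a sum of functionals on the two
    components adds their moments. *)
Definition pair_amul (x y : A * B) : A * B := (amul x.1 y.1, amul x.2 y.2).

Lemma pair_amulA : associative pair_amul.
Proof. by move=> x y z; rewrite /pair_amul !amulA. Qed.
Lemma pair_amulDl : left_distributive pair_amul +%R.
Proof. by move=> x y z; congr pair; exact: amulDl. Qed.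
Lemma pair_amulDr : right_distributive pair_amul +%R.
Proof. by move=> x y z; congr pair; exact: amulDr. Qed.
Lemma pair_amulZl (c : K) x y : pair_amul (c *: x) y = c *: pair_amul x y.
Proof. by congr pair; exact: amulZl. Qed.
Lemma pair_amulZr (c : K) x y : pair_amul x (c *: y) = c *: pair_amul x y.
Proof. by congr pair; exact: amulZr. Qed.

HB.instance Definition _ := Lmodule_isAssocAlgebra.Build K (A * B)%type
  pair_amulA pair_amulDl pair_amulDr pair_amulZl pair_amulZr.

Lemma subst_pair X (a : X -> A) (b : X -> B) (M : fsg X) :
  subst (fun x => (a x, b x) : A * B) M = (subst a M, subst b M).
Proof.
case: M => x s; rewrite /subst /=.
by elim: s (a x) (b x) => //= y s IHs p q; rewrite IHs.
Qed.

End ProductAlgebra.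

Section Tensor.
Variables (K : fieldType) (k : nat) (e : altseq k).

(** Three families agreeing away from [l] express multilinearity without updating an entry of a
    dependent family. *)
Lemma tensor_linear (A : 'I_k -> assocAlgType K) l c
    (a b b' : forall l : 'I_(size e), A (tnth (in_tuple e) l)) :
  a l = c *: b l + b' l ->
  (forall l', l' != l -> a l' = b l' /\ a l' = b' l') ->
  tensor e a = c *: tensor e b + tensor e b'.
Proof.
move=> al anl; apply: fp_evalP => E f fm.
rewrite fp_eval_linear // !fp_evalE //= /tensor_word.
have /splitPr enumE : l \in enum 'I_(size e) by rewrite mem_enum.
have := enum_uniq 'I_(size e); have := alternating_tensor_word a.
rewrite /tensor_word; case: enumE => u v; rewrite map_cat /= => alt.
rewrite cat_uniq /= negb_or => /and3P[_ /andP[lu _] /andP[lv _]].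
have out b0 (s : seq 'I_(size e)) : l \notin s ->
    (forall l', l' != l -> a l' = b0 l') ->
    [seq Tagged A (b0 l') | l' <- s] = [seq Tagged A (a l') | l' <- s].
  move=> ls ab; apply/eq_in_map => l' l's; rewrite ab //.
  by apply: contraNneq ls => <-.
have anl1 l' : l' != l -> a l' = b l' by case/anl.
have anl2 l' : l' != l -> a l' = b' l' by case/anl.
rewrite !map_cat /= !(out b) // !(out b') // al; apply: fm.
by move: alt; rewrite /tags map_cat.
Qed.

Lemma tensor0 (A : 'I_k -> assocAlgType K) l
    (a : forall l : 'I_(size e), A (tnth (in_tuple e) l)) :
  a l = 0 -> tensor e a = 0.
Proof.
move=> al; have := @tensor_linear A l 1 a a a; rewrite al scaler0 addr0 scale1r.
move/(_ erefl (fun _ _ => conj erefl erefl))/eqP.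
by rewrite -subr_eq subrr eq_sym => /eqP.
Qed.

Lemma fp_map_tensor (A B : 'I_k -> assocAlgType K) (j : forall i, alg_hom (B i) (A i))
    (b : forall l : 'I_(size e), B (tnth (in_tuple e) l)) :
  fp_map j (tensor e b) = tensor e (fun l => j _ (b l)).
Proof.
(* The identity of [free_product A] is the lift of the injections; this writes the right-hand tensor
   as a product of its factors, like the image on the left. *)
have idM : {morph (idfun : free_product A -> free_product A) : x y / amul x y} by [].
rewrite {2}/tensor [RHS](fp_lift_pt (g := AlgHom idM) (f := @fp_inj K k A)) //=.
rewrite /tensor fp_evalE; last exact: word_lift_multilinear.
rewrite /= /tensor_word.
by elim: (enum _) => //= l [|l' s] //= ->.
Qed.

End Tensor.

(** All bundled data beyond the map are proofs. Genuine equality is needed to replace functionals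
    inside a universal product. *)
Lemma scalar_eq (K : pzSemiRingType) (U : lSemiModType K) (f g : {scalar U}) :
  f =1 g -> f = g.
Proof.
case: f g => [f [[a] [b]]] [g [[a'] [b']]] /= /funext fg.
case: g / fg in a' b' *.
by rewrite (Prop_irrelevance a a') (Prop_irrelevance b b').
Qed.

Section FreeValue.
Variables (K : fieldType) (d k : nat) (odot : universal_product K d k) (e : altseq k).

Definition moment_index := {i : 'I_k & (fsg (colour e i) * 'I_d)%type}.

Definition index_word (q : moment_index) : seq 'I_(size e) :=
  [seq val x | x <- letters (tagged q).1].

Definition extend_scalar (X : choiceType) (f : fsg X -> K) : {scalar free_alg K X} :=
  HB.pack (extend (f : fsg X -> K^o)) (GRing.isLinear.Build K (free_alg K X) K *%R
    (extend (f : fsg X -> K^o)) (extend_linear (f : fsg X -> K^o))).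

Definition colour_alg (i : 'I_k) : assocAlgType K := free_alg K (colour e i).

Definition functionals_of (psi : moment_index -> K) (i : 'I_k) :
    functionals d (colour_alg i) :=
  fun c => extend_scalar (fun M => psi (Tagged _ (M, c))).

Definition letter_in (l : 'I_(size e)) : colour e (tnth (in_tuple e) l) :=
  exist _ l (eqxx _).

(** The function [F] of the overview; any [psi] is allowed because words form a basis of the free
    algebras. *)
Definition free_value (c : 'I_d) (psi : moment_index -> K) : K :=
  uprod odot (functionals_of psi) c (tensor e (fun l => gen K (letter_in l))).

Definition index_moment (A : 'I_k -> assocAlgType K) (phi : forall i, functionals d (A i))
    (a : forall l : 'I_(size e), A (tnth (in_tuple e) l)) (q : moment_index) : K :=
  phi (tag q) (tagged q).2 (subst (colour_factor a (i := tag q)) (tagged q).1).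

Lemma colour_factor_letter (A : 'I_k -> assocAlgType K)
    (a : forall l : 'I_(size e), A (tnth (in_tuple e) l)) l :
  colour_factor a (letter_in l) = a l.
Proof. by rewrite /colour_factor /= eq_axiomK. Qed.

(** Destructing the colour proof of a variable turns its colour into that of [l], where the cast in
    [colour_factor] is trivial. *)
Lemma colour_factorE (A : 'I_k -> assocAlgType K)
    (f : forall l : 'I_(size e), A (tnth (in_tuple e) l))
    (g : forall i, colour e i -> A i) :
  (forall l, f l = g _ (letter_in l)) ->
  forall i (x : colour e i), colour_factor f x = g i x.
Proof.
move=> fg i [l p]; have ei := eqP p; case: i / ei p => p.
by rewrite (bool_irrelevance p (eqxx _)) colour_factor_letter.
Qed.

(** Universality is applied to the homomorphisms substituting [a_l] for [x_l]; the pulled back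
    functionals are fixed by their values on words, which are the moments of the [a_l]. *)
Lemma uprod_tensor c (A : 'I_k -> assocAlgType K) (phi : forall i, functionals d (A i))
    (a : forall l : 'I_(size e), A (tnth (in_tuple e) l)) :
  uprod odot phi c (tensor e a) = free_value c (index_moment phi a).
Proof.
pose j i := fa_lift (colour_factor a (i := i)).
have -> : tensor e a = fp_map j (tensor e (fun l => gen K (letter_in l))).
  rewrite fp_map_tensor; congr tensor; apply: functional_extensionality_dep => l.
  by rewrite fa_lift_monomial /subst /= colour_factor_letter.
rewrite uprod_universal; congr (uprod odot _ c _).
apply: functional_extensionality_dep => i; apply/funext => l.
apply: scalar_eq; apply: (@free_alg_ext K _ K^o) => [||u].
- exact: linearP.
- exact: linearP.
by rewrite /functionals_of /= !extend_monomial.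
Qed.

Lemma prod_scale_letter l (c : K) (s : seq 'I_(size e)) :
  \prod_(l' <- s) (if l' == l then c else 1) = c ^+ count_mem l s.
Proof. by rewrite -big_mkcond big_const_seq iter_mulr mulr1. Qed.

Lemma colour_factor_scaled_gen (f : 'I_(size e) -> K) i :
  colour_factor (A := colour_alg) (fun l => f l *: gen K (letter_in l)) (i := i) =
  fun x => f (val x) *: gen K x.
Proof.
apply/funext => x.
by apply: (@colour_factorE colour_alg _
  (fun i (x : colour e i) => f (val x) *: gen K x)).
Qed.

Lemma extend_scaled_monomial (f : 'I_(size e) -> K) psi (q : moment_index) :
  functionals_of psi (tag q) (tagged q).2
    (subst (fun x : colour e (tag q) => f (val x) *: gen K x) (tagged q).1) =
  \prod_(l <- index_word q) f l * psi q.
Proof.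
rewrite subst_scaled_gen linearZ /= extend_monomial big_map.
by case: q => i [M c].
Qed.

Lemma free_value_homogeneous c : letterwise_homogeneous index_word (free_value c).
Proof.
move=> l t psi; pose f r l' : K := if l' == l then r else 1.
have -> : (fun q => t ^+ count_mem l (index_word q) * psi q) =
    index_moment (A := colour_alg) (functionals_of psi)
      (fun l' => f t l' *: gen K (letter_in l')).
  apply/funext => q; rewrite /index_moment colour_factor_scaled_gen.
  by rewrite extend_scaled_monomial prod_scale_letter.
(* The second summand has [l]-th factor [0] and vanishes, which turns linearity into homogeneity. *)
rewrite -uprod_tensor (@tensor_linear _ _ _ _ l t _
  (fun l => gen K (letter_in l)) (fun l' => f 0 l' *: gen K (letter_in l'))).
- rewrite [X in _ + X](@tensor0 _ _ _ _ l) ?addr0 ?linearZ //.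
  by rewrite /f eqxx scale0r.
- by rewrite /f eqxx scale0r addr0.
- by move=> l' ne; rewrite /f (negPf ne) scale1r.
Qed.

Definition pair_functional (U V : lmodType K) (f : {scalar U}) (g : {scalar V})
  (x : (U * V)%type) : K := f x.1 + g x.2.

Lemma pair_functional_linear (U V : lmodType K) (f : {scalar U}) (g : {scalar V}) :
  scalar (pair_functional f g).
Proof. by move=> c x y; rewrite /pair_functional !linearP mulrDr addrACA. Qed.

Definition pair_scalar (U V : lmodType K) (f : {scalar U}) (g : {scalar V}) :
    {scalar (U * V)%type} :=
  HB.pack (pair_functional f g) (GRing.isLinear.Build K (U * V)%type K *%R
    (pair_functional f g) (pair_functional_linear f g)).

(* On the square of the free algebra take psi1 on the first factor and psi2 on the
   second one, corrected by psi0 so as to count the words without x_l only once;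
   then x_l = (x_l, 0) + (0, x_l) splits the moments of the words containing x_l. *)
Lemma free_value_additive c : letterwise_additive index_word (free_value c).
Proof.
move=> l psi1 psi2 psi out inn; pose f r l' : K := if l' == l then r else 1.
pose psi0 q := psi2 q - (if l \in index_word q then 0 else psi q).
pose A i : assocAlgType K := (colour_alg i * colour_alg i)%type.
pose phi i : functionals d (A i) := fun c =>
  pair_scalar (functionals_of psi1 i c) (functionals_of psi0 i c).
(* [x_l] is scaled by [r] in the first component and by [s] in the second, so that [a 1 1] splits at
   [l] into [a 1 0] and [a 0 1]. *)
pose a r s l' : A (tnth (in_tuple e) l') :=
  (f r l' *: gen K (letter_in l'), f s l' *: gen K (letter_in l')).
have mom r s : free_value c (fun q => r ^+ count_mem l (index_word q) * psi1 q +
    s ^+ count_mem l (index_word q) * psi0 q) = uprod odot phi c (tensor e (a r s)).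
  rewrite uprod_tensor; congr free_value; apply/funext => q.
  rewrite /index_moment.
  have -> : colour_factor (a r s) (i := tag q) =
      fun x => (f r (val x) *: gen K x, f s (val x) *: gen K x).
    apply/funext => x; by apply: (@colour_factorE A _ (fun i (x : colour e i) =>
      (f r (val x) *: gen K x, f s (val x) *: gen K x))).
  rewrite subst_pair /phi /= /pair_functional !extend_scaled_monomial.
  by rewrite !prod_scale_letter.
(* A scalar [0] erases exactly the moments containing [l], since [0 ^+ 0 = 1] preserves the
   others. *)
have cnt q : l \in index_word q -> 0 ^+ count_mem l (index_word q) = 0 :> K.
  by rewrite -has_pred1 has_count expr0n; case: count.
transitivity (uprod odot phi c (tensor e (a 1 1))).
  rewrite -mom; congr free_value; apply/funext => q; rewrite !expr1n !mul1r /psi0.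
  case: ifPn => lq; first by rewrite subr0 inn.
  by have [-> ->] := out q lq; rewrite subrr addr0.
rewrite (@tensor_linear _ _ _ _ l 1 _ (a 1 0) (a 0 1)).
- rewrite scale1r linearD -!mom; congr (free_value _ _ + free_value _ _);
    apply/funext => q; rewrite expr1n mul1r /psi0; case: ifPn => lq.
  + by rewrite cnt // mul0r addr0.
  + by have [_ ->] := out q lq; rewrite subrr mulr0 addr0.
  + by rewrite cnt // mul0r add0r subr0.
  + have [-> ->] := out q lq; rewrite subrr addr0 (count_memPn lq).
    by rewrite expr0 mul1r.
- rewrite /a /f eqxx !scale1r !scale0r.
  by rewrite -{1}[gen K _]addr0 -{2}[gen K _]add0r.
- by move=> l' ne; rewrite /a /f (negPf ne).
Qed.

End FreeValue.

(** * Exact covers by words *)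

Lemma count1_inj (T : eqType) (a : pred T) (s : seq T) x y :
  count a s = 1%N -> x \in s -> y \in s -> a x -> a y -> x = y.
Proof.
rewrite -size_filter => s1 xs ys ax ay.
have: x \in filter a s by rewrite mem_filter ax.
have: y \in filter a s by rewrite mem_filter ay.
by case: filter s1 => [|z [|]] // _; rewrite !inE => /eqP -> /eqP ->.
Qed.

Lemma count1_uniq (T : eqType) (a : pred T) (s : seq T) x : uniq s ->
  x \in s -> a x -> (forall y, y \in s -> a y -> y = x) -> count a s = 1%N.
Proof.
move=> us xs ax ay; transitivity (count_mem x s).
  by apply: eq_in_count => y ys /=; apply/idP/eqP => [/ay->|->].
by rewrite count_uniq_mem ?xs.
Qed.

Section Covers.
Variables (d : nat) (X : finType).

(** A letter shared by two words, or by two copies of one word, is counted twice. Unlike the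
    pairwise form, counts pass easily through permutations. *)
Lemma pairwise_disjointP (t : seq (fsg X)) :
  reflect (forall x, (count (fun M => x \in letters M) t <= 1)%N)
    (pairwise (fun M N => [disjoint word_set M & word_set N]) t).
Proof.
apply: (iffP idP) => [|h].
  elim: t => //= M t IHt /andP[/allP dis /IHt h] x; have := h x.
  case: (boolP (x \in letters M)) => // xM _.
  rewrite [X in (_ + X)%N](_ : _ = 0)%N //; apply/eqP.
  rewrite eqn0Ngt -has_count; apply/hasPn => N /dis /disjoint_setI0 /setP /(_ x).
  by rewrite finset.in_setI !finset.in_set xM /= => ->.
elim: t h => //= M t IHt h; apply/andP; split; last first.
  by apply: IHt => x; apply: leq_trans (h x); apply: leq_addl.
apply/allP => N Nt; rewrite -finset.setI_eq0; apply/eqP/setP => x;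
  rewrite finset.in_setI !finset.in_set; apply/negbTE.
apply: contraTN (h x) => /andP[-> xN]; rewrite -ltnNge add1n !ltnS -has_count.
by apply/hasP; exists N.
Qed.

Lemma sum_count_letters (t : seq (fsg X)) :
  (\sum_(x : X) count (fun M => x \in letters M) t = \sum_(M <- t) #|word_set M|)%N.
Proof.
elim: t => [|M t IHt] /=; first by rewrite big_nil big1.
rewrite big_cons -IHt big_split /=; congr addn.
rewrite /word_set cardsE -sum1_card [RHS]big_mkcond.
by apply: eq_bigr => x _; rewrite !inE; case: (_ || _).
Qed.

(** Disjointness covers each letter at most once, and the total length [#|X|] then leaves no letter
    uncovered. *)
Lemma inMdP (pi : {mset fsg X * 'I_d}) :
  reflect ((forall p, p \in pi -> uniq (letters p.1)) /\
           (forall x, count (fun p => x \in letters p.1) pi = 1%N)) (inMd pi).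
Proof.
rewrite /inMd /inM; set t := seq_mset _.
have pt : perm_eq t [seq p.1 | p <- pi] by exact: perm_eq_seq_mset.
have -> : all (fun M => #|word_set M| == size (letters M)) t =
    all (fun M => uniq (letters M)) t.
  by apply: eq_all => M; rewrite cardsE; apply/eqP/card_uniqP.
have cnt x : count (fun M => x \in letters M) t = count (fun p => x \in letters p.1) pi.
  by rewrite (permP pt) count_map.
have <- : all (fun p => uniq (letters p.1)) pi = all (fun M => uniq (letters M)) t.
  by rewrite (perm_all _ pt) all_map.
have sumE : all (fun p => uniq (letters p.1)) pi ->
    (\sum_(M <- t) size (letters M) =
     \sum_(x : X) count (fun p => x \in letters p.1) pi)%N.
  move=> /allP un; under [RHS]eq_bigr do rewrite -cnt.
  rewrite sum_count_letters; apply: eq_big_seq => M.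
  rewrite (perm_mem pt) => /mapP[p ppi ->]; rewrite cardsE.
  by apply/esym/card_uniqP/un.
apply: (iffP and3P) => [[/eqP sz /pairwise_disjointP le1 un]|[/allP un c1]].
  split; first exact/allP.
  move: sz; rewrite sumE // -sum1_card => /eqP sz x.
  have le x' : (count (fun p => x' \in letters p.1) pi <= 1)%N by rewrite -cnt.
  (* Equality case: terms at most [1] whose sum is the number of terms are all [1]. *)
  have := leqif_sum (fun x' (_ : true) => leqif_eq (le x')).
  by move=> [_]; rewrite sz => /esym/forallP/(_ x)/eqP.
split => //; last by apply/pairwise_disjointP => x; rewrite cnt c1.
by rewrite sumE // -sum1_card; apply/eqP/eq_bigr => x _.
Qed.

(** The first letter of a factor [p] of [pi] lies in some factor of [pi'], which is also a factor of
    [pi] and hence equals [p]. Multiplicities are at most [1]. *)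
Lemma inMd_sub (pi pi' : {mset fsg X * 'I_d}) : inMd pi -> inMd pi' ->
  {subset pi' <= pi} -> pi' = pi.
Proof.
move=> /inMdP[_ c1] /inMdP[_ c1'] spi.
have mem1 (rho : {mset fsg X * 'I_d}) p :
    (forall x, count (fun q => x \in letters q.1) rho = 1%N) ->
    rho p = (p \in rho) :> nat.
  move=> rho1; rewrite in_mset -count_mem_mset.
  suff: (count_mem p rho <= 1)%N by case: (count_mem p rho) => [|[|]].
  rewrite -(rho1 p.1.1); apply: sub_count => q /= /eqP ->; exact: mem_head.
apply/msetP => p; rewrite !mem1 //; congr nat_of_bool.
apply/idP/idP => [/spi //|ppi].
have: has (fun q => p.1.1 \in letters q.1) pi' by rewrite has_count c1'.
case/hasP => q qpi' xq; rewrite (count1_inj (c1 p.1.1) ppi (spi q qpi')) //.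
exact: mem_head.
Qed.

Definition uniq_words : seq (fsg X * 'I_d) := undup
  [seq (M, c) | M <- [seq (x, s) | x <- enum X, s <- bseqs (enum X) #|X|],
                c <- enum 'I_d].

Lemma mem_uniq_words p : uniq (letters p.1) -> p \in uniq_words.
Proof.
case: p => [[x s] c] /= /andP[_ us]; rewrite mem_undup.
apply: allpairs_f; last by rewrite mem_enum.
apply: allpairs_f; first by rewrite mem_enum.
apply: mem_bseqs; first by rewrite -(card_uniqP us) max_card.
by apply/allP => y _; rewrite mem_enum.
Qed.

End Covers.

(** * Products of moments as letterwise functions *)

Section LetterwiseMonomial.
Variables (K : comPzRingType) (L : finType) (T : eqType) (w : T -> seq L).
Variable s : seq T.
Hypothesis s1 : forall l, count (fun q => l \in w q) s = 1%N.

(** Exactly one factor contains [l]; the product is additive in it, and the other factors are common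
    to the three families. *)
Lemma prod_letterwise_additive :
  letterwise_additive w (fun psi : T -> K => \prod_(q <- s) psi q).
Proof.
move=> l psi1 psi2 psi out inn.
have: has (fun q => l \in w q) s by rewrite has_count s1.
case/hasP => q0 q0s lq0; case/splitPr: q0s (s1 l) => s2 s3.
rewrite count_cat /= lq0 => /eqP; rewrite addnCA add1n eqSS addn_eq0.
rewrite !eqn0Ngt -!has_count => /andP[/hasPn h2 /hasPn h3].
have outE (f : T -> K) (r : seq T) :
    (forall q, l \notin w q -> f q = psi q) -> (forall q, q \in r -> l \notin w q) ->
    \prod_(q <- r) f q = \prod_(q <- r) psi q.
  by move=> fo ro; apply: eq_big_seq => q /ro; exact: fo.
rewrite !big_cat !big_cons /= inn // mulrDl mulrDr.
by rewrite !(outE psi1) ?(outE psi2) // => q /out[].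
Qed.

Lemma prod_letterwise_homogeneous : (forall q, q \in s -> uniq (w q)) ->
  letterwise_homogeneous w (fun psi : T -> K => \prod_(q <- s) psi q).
Proof.
move=> un l c psi; rewrite big_split /= prodrXr.
suff -> : (\sum_(q <- s) count_mem l (w q) = 1)%N by rewrite expr1.
rewrite -(s1 l) -sum1_count [RHS]big_mkcond; apply: eq_big_seq => q qs.
by rewrite count_uniq_mem ?un //; case: (_ \in _).
Qed.

End LetterwiseMonomial.

(** * Tuples of multisets as single lists of moment indices *)

Section Flat.
Variables (d k : nat) (e : altseq k).
Implicit Types pi : mset_family d e.

Local Notation at_colour p :=
  (Tagged (fun i => (fsg (colour e i) * 'I_d)%type) p : moment_index d e).

Definition flat pi : seq (moment_index d e) :=
  flatten [seq [seq at_colour p | p <- pi i] | i <- enum 'I_k].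

Lemma mem_flat pi q : (q \in flat pi) = (tagged q \in pi (tag q)).
Proof.
apply/flatten_mapP/idP => [[i _ /mapP[p ppi ->]] //|].
case: q => i p /= ppi; exists i; first by rewrite mem_enum.
exact: map_f.
Qed.

Lemma momentE (K : fieldType) (A : 'I_k -> assocAlgType K)
    (phi : forall i, functionals d (A i))
    (a : forall l : 'I_(size e), A (tnth (in_tuple e) l)) pi :
  moment phi a pi = \prod_(q <- flat pi) index_moment phi a q.
Proof.
rewrite /flat big_flatten big_map /= big_enum /=; apply: eq_bigr => i _.
by rewrite big_map.
Qed.

Lemma mem_index_word l (p : fsg (colour e (tnth (in_tuple e) l)) * 'I_d) :
  (l \in index_word (at_colour p : moment_index d e)) = (letter_in l \in letters p.1).
Proof. by rewrite -[RHS](mem_map val_inj). Qed.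

Lemma index_word_tag l (q : moment_index d e) :
  l \in index_word q -> tag q = tnth (in_tuple e) l.
Proof. by case/mapP => x _ ->; rewrite (eqP (valP x)). Qed.

Lemma uniq_index_word (q : moment_index d e) :
  uniq (index_word q) = uniq (letters (tagged q).1).
Proof. by rewrite /index_word map_inj_uniq //; exact: val_inj. Qed.

Lemma count_index_word l pi :
  count (fun q => l \in index_word q) (flat pi) =
  count (fun p => letter_in l \in letters p.1) (pi (tnth (in_tuple e) l)).
Proof.
rewrite count_flatten sumnE 2!big_map big_enum /= (bigD1 (tnth (in_tuple e) l)) //=.
rewrite big1 => [|i ne].
  by rewrite addn0 count_map; apply: eq_count => p /=; exact: mem_index_word.
apply/eqP; rewrite eqn0Ngt -has_count; apply/hasPn => _ /mapP[p _ ->].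
by apply: contra ne => /index_word_tag /= ->.
Qed.

(** Each letter has a single colour, so only the multiset of that colour contributes to its
    count. *)
Lemma Md_familyP pi : Md_family d e pi <->
  (forall q, q \in flat pi -> uniq (index_word q)) /\
  (forall l, count (fun q => l \in index_word q) (flat pi) = 1%N).
Proof.
split=> [piM|[un c1] i].
  split=> [q|l]; first rewrite mem_flat uniq_index_word.
    by have /inMdP[un _] := piM (tag q); exact: un.
  rewrite count_index_word; have /inMdP[_ ->] // := piM (tnth (in_tuple e) l).
apply/inMdP; split=> [p ppi|[l p]].
  by rewrite -(uniq_index_word (at_colour p)) un // mem_flat.
have ei := eqP p; case: i / ei p => p.
by rewrite (bool_irrelevance p (eqxx _)) -(count_index_word l).
Qed.

Lemma Md_family_sub pi pi' : Md_family d e pi -> Md_family d e pi' ->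
  {subset flat pi' <= flat pi} -> pi' = pi.
Proof.
move=> piM piM' spi; apply/ffunP => i; apply: inMd_sub => // p.
by have := spi (at_colour p); rewrite !mem_flat.
Qed.

Definition uniq_indices : seq (moment_index d e) :=
  flatten [seq [seq at_colour p | p <- uniq_words d (colour e i)] | i <- enum 'I_k].

Lemma mem_uniq_indices q : uniq (index_word q) -> q \in uniq_indices.
Proof.
rewrite uniq_index_word => uq; apply/flatten_mapP.
exists (tag q); first by rewrite mem_enum.
by case: q uq => i p /= /mem_uniq_words; exact: map_f.
Qed.

Lemma exact_cover_flat (S : pred (moment_index d e)) :
  exact_cover (@index_word d k e) S ->
  exists2 pi, Md_family d e pi & S =1 [in flat pi].
Proof.
case=> un cov.
(* Words of [S] have no repetition, so the filtered finite lists miss none of them. *)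
pose pi : mset_family d e := [ffun i => seq_mset
  [seq p <- uniq_words d (colour e i) | S (at_colour p)]].
have piE i : perm_eq (pi i) [seq p <- uniq_words d (colour e i) | S (at_colour p)].
  by rewrite ffunE perm_eq_seq_mset.
have Spi : S =1 [in flat pi].
  move=> q /=; rewrite mem_flat (perm_mem (piE _)) mem_filter.
  case: q => i p; case: (boolP (S _)) => //= /un; rewrite uniq_index_word.
  by move/mem_uniq_words.
exists pi => //; apply/Md_familyP; split=> [q|l]; first by rewrite -Spi => /un.
have [[i p] [Sq lq] qu] := cov l.
have /= ei := index_word_tag lq; subst i.
rewrite count_index_word (permP (piE _)).
apply: (@count1_uniq _ _ _ p); rewrite ?filter_uniq ?undup_uniq //.
- rewrite mem_filter Sq mem_uniq_words //.
  by have := un _ Sq; rewrite uniq_index_word.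
- by rewrite -mem_index_word.
move=> p'; rewrite mem_filter => /andP[Sp' _]; rewrite -mem_index_word => lp'.
by have /eqP := qu _ Sp' lp'; rewrite eq_Tagged => /eqP.
Qed.

End Flat.

(** * Existence and uniqueness of the expansion *)

Section Expansion.
Variables (K : numFieldType) (d k : nat) (odot : universal_product K d k) (e : altseq k).
Implicit Types pi : mset_family d e.

Definition indicator pi : moment_index d e -> K := fun q => (q \in flat pi)%:R.

Definition coefficient pi : 'rV[K]_d := \row_c free_value odot c (indicator pi).

Definition Md_list : seq (mset_family d e) := fset_set (Md_family d e).

Lemma mem_Md_list pi : (pi \in Md_list) <-> Md_family d e pi.
Proof. by rewrite /Md_list in_fset_set ?inE //; exact: finite_Md_family. Qed.

Lemma sum_Md_family (V : nmodType) (F : mset_family d e -> V) :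
  \sum_(pi \in Md_family d e) F pi = \sum_(pi <- Md_list) F pi.
Proof. by rewrite fsbig_finite //; exact: finite_Md_family. Qed.

(** Either some factor of [pi'] is absent from [pi] and contributes [0], or inclusion of the factors
    forces the two covers to agree. *)
Lemma prod_indicator pi pi' : Md_family d e pi -> Md_family d e pi' ->
  \prod_(q <- flat pi') indicator pi q = (pi' == pi)%:R.
Proof.
move=> piM piM'; have [->|ne] := eqVneq pi' pi.
  by rewrite big1_seq // => q /= qpi; rewrite /indicator qpi.
have [/hasP[q qpi' qpi]|/hasPn none] :=
    boolP (has [pred q | q \notin flat pi] (flat pi')).
  by rewrite (big_rem q) //= /indicator (negPf qpi) mul0r.
case/eqP: ne; apply: Md_family_sub => // q /none /=.
by rewrite negbK.
Qed.

Lemma sum_indicator (V : lmodType K) (F : mset_family d e -> V) pi :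
  Md_family d e pi ->
  \sum_(pi' <- Md_list) (\prod_(q <- flat pi') indicator pi q) *: F pi' = F pi.
Proof.
move=> piM; rewrite (big_rem pi) /=; last exact/mem_Md_list.
rewrite prod_indicator // eqxx scale1r big1_seq ?addr0 // => pi' /=.
rewrite mem_rem_uniq ?fset_uniq // inE => /andP[ne /mem_Md_list piM'].
by rewrite prod_indicator // (negPf ne) scale0r.
Qed.

Lemma free_value_expansion c psi : free_value odot c psi =
  \sum_(pi <- Md_list)
    (\prod_(q <- flat pi) psi q) *: (free_value odot c (indicator pi) : K^o).
Proof.
(* Both terms are letterwise additive and homogeneous, and they agree at the indicator of an exact
   cover, where a single monomial survives. *)
pose G psi := free_value odot c psi -
  \sum_(pi <- Md_list) (\prod_(q <- flat pi) psi q) * free_value odot c (indicator pi).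
apply/eqP; rewrite -subr_eq0; apply/eqP; rewrite -[LHS]/(G psi).
apply: (@letterwise_eq0 _ _ _ (@index_word d k e) _ _ _ (uniq_indices d e)).
- move=> l psi1 psi2 psi' out inn; rewrite /G (free_value_additive _ _ out inn) addrACA.
  congr (_ + _); rewrite -opprD -big_split /=; congr (- _).
  apply: eq_big_seq => pi /mem_Md_list /Md_familyP[_ c1].
  by rewrite (prod_letterwise_additive c1 out inn) mulrDl.
- move=> l t psi'; rewrite /G free_value_homogeneous mulrBr mulr_sumr; congr (_ - _).
  apply: eq_big_seq => pi /mem_Md_list /Md_familyP[un c1].
  by rewrite (prod_letterwise_homogeneous c1 un) mulrA.
- exact: mem_uniq_indices.
- by [].
move=> S /exact_cover_flat[pi piM Spi].
have -> : (fun q => (S q)%:R) = indicator pi by apply/funext => q; rewrite Spi.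
rewrite /G; have := sum_indicator (fun pi => free_value odot c (indicator pi) : K^o) piM.
by move=> ->; rewrite subrr.
Qed.

Lemma is_expansion_coefficient : is_expansion e odot coefficient.
Proof.
move=> A phi a; apply/rowP => c; rewrite sum_Md_family summxE mxE uprod_tensor.
rewrite free_value_expansion; apply: eq_bigr => pi _.
by rewrite !mxE momentE.
Qed.

Lemma is_expansion_unique beta pi : is_expansion e odot beta -> Md_family d e pi ->
  beta pi = coefficient pi.
Proof.
(* On the free generators, with functionals whose moments are [indicator pi], the expansion reduces
   to its term at [pi]. *)
move=> + piM => /(_ _ (functionals_of (indicator pi)) (fun l => gen K (letter_in l))).
have mom (q : moment_index d e) : index_moment (A := colour_alg K e)
    (functionals_of (indicator pi)) (fun l => gen K (letter_in l)) q = indicator pi q.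
  have one : \prod_(l <- index_word q) 1 = 1 :> K by rewrite big1_eq.
  have -> : (fun l => gen K (letter_in l)) =
      (fun l => 1 *: gen K (letter_in l))
      :> forall l, colour_alg K e (tnth (in_tuple e) l).
    by apply: functional_extensionality_dep => l; rewrite scale1r.
  rewrite /index_moment (colour_factor_scaled_gen (fun=> 1)).
  by rewrite (extend_scaled_monomial (fun=> 1)) one mul1r.
rewrite sum_Md_family; under eq_bigr do rewrite (momentE (A := colour_alg K e)).
under eq_bigr do under eq_bigr do rewrite mom.
by rewrite sum_indicator // => <-.
Qed.

End Expansion.

Local Open Scope complex_scope.

Theorem theorem5p2 (R : realType) (d k : nat)
    (odot : universal_product R[i] d k) (e : altseq k) :
  exists alpha : mset_family d e -> 'rV[R[i]]_d,
    is_expansion e odot alpha /\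
    (forall beta : mset_family d e -> 'rV[R[i]]_d,
       is_expansion e odot beta ->
       forall pi : mset_family d e, Md_family d e pi -> beta pi = alpha pi).
Proof.
exists (coefficient odot (e := e)); split; first exact: is_expansion_coefficient.
by move=> beta betaE pi; exact: is_expansion_unique.
Qed.
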